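(* Let $(V,p,e)$ be a complete hyperbolic system of degree $n$ whose hyperbolicity cone $\Lambda_+$ is an ROG-cone. Then $(V,p,e)$ has a scaled Jordan frame.
   Context: Let $V$ be a finite-dimensional real vector space and $e\in V$ nonzero. A homogeneous polynomial $p$ of degree $n$ on $V$ is hyperbolic in the direction $e$ if $p(e)\ne 0$ and for every $x\in V$ the univariate polynomial $t\mapsto p(te-x)$ has only real zeros; then $(V,p,e)$ is called a hyperbolic system of degree $n$. Standing assumption: $n\ge 2$. The eigenvalue map $\lambda:V\to\mathbb{R}^n$ sends $x$ to the vector $(\lambda_1(x),\ldots,\lambda_n(x))^T$ of roots of $t\mapsto p(te-x)$, with multiplicity, in decreasing order. The system is complete if $\lambda(x)=0$ implies $x=0$. The hyperbolicity cone is $\Lambda_+=\{x\in V:\lambda(x)\ge 0\}$ and its interior is $\Lambda_{++}=\{x\in V:\lambda(x)>0\}$ (entrywise inequalities). An element $c\in V$ is of rank one if $\lambda(c)$ has exactly one nonzero entry (counted with multiplicity). $\Lambda_+$ is an ROG-cone (rank-one generated) if it is pointed and every extreme direction of $\Lambda_+$ is generated by a rank-one element, i.e. an element $x$ with $\lambda_1(x)>0$ and $\lambda_2(x)=\cdots=\lambda_n(x)=0$. A scaled Jordan frame in $(V,p,e)$ is a finite family $c_1,\ldots,c_k$ (repetitions allowed) of rank-one elements of $\Lambda_+$ with $c_1+\cdots+c_k\in\Lambda_{++}$. *)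

(* Defs.v *)
(* MathComp, with classical sets from MathComp-Analysis and polynomials in
   several variables from multinomials. *)
From mathcomp Require Import all_boot all_order all_algebra.
From mathcomp Require Import complex mpoly.
From mathcomp Require Import boolp classical_sets reals.

Set Implicit Arguments.
Unset Strict Implicit.
Unset Printing Implicit Defensive.

Import Order.TTheory GRing.Theory Num.Theory.
Local Open Scope classical_set_scope.
Local Open Scope ring_scope.

Section HyperbolicSystems.
Variables (R : realType) (V : vectType R).

(* Polynomials on V, written in the coordinates of the basis vbasis fullv.
   As every polynomial function on V has exactly one such expression and
   linear changes of coordinates preserve homogeneity, the choice of basis is
   immaterial. *)
Definition polyOn : Type := {mpoly R[\dim {:V}]}.

Definition vcoord (x : V) (i : 'I_(\dim {:V})) : R := coord (vbasis {:V}) i x.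

Definition peval (p : polyOn) (x : V) : R := meval (vcoord x) p.

Definition homogeneous_of_degree (n : nat) (p : polyOn) : Prop :=
  p \is n.-homog.

(* The univariate polynomial t |-> p (t e - x). *)
Definition pencil (p : polyOn) (e x : V) : {poly R} :=
  mmap (@polyC R) (fun i => vcoord e i *: 'X - (vcoord x i)%:P) p.

Lemma horner_pencil (p : polyOn) (e x : V) (t : R) :
  (pencil p e x).[t] = peval p (t *: e - x).
Proof.
rewrite /pencil /peval /meval /mmap horner_sum; apply: eq_bigr => m _.
rewrite hornerM hornerC /mmap1 horner_prod; congr (_ * _).
apply: eq_bigr => i _; rewrite horner_exp !hornerE /vcoord.
by rewrite linearB linearZ /= mulrC.
Qed.

Definition only_real_zeros (q : {poly R}) : Prop :=
  forall z : complex R, root (map_poly (@real_complex R) q) z -> complex.Im z = 0.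

Definition hyperbolic_system (n : nat) (p : polyOn) (e : V) : Prop :=
  [/\ e != 0, homogeneous_of_degree n p, peval p e != 0
    & forall x : V, only_real_zeros (pencil p e x)].

Definition is_eigenvalue_vector (n : nat) (p : polyOn) (e x : V)
    (v : 'cV[R]_n) : Prop :=
  (forall i j : 'I_n, (i <= j)%N -> v j 0 <= v i 0) /\
  (forall a : R, #|[set i : 'I_n | v i 0 == a]%SET| = mup a (pencil p e x)).

(* For a hyperbolic system of degree n this is the unique vector with the
   property above; otherwise the value may be the junk value 0. *)
Definition eigenvalues (n : nat) (p : polyOn) (e x : V) : 'cV[R]_n :=
  xget 0 [set v | @is_eigenvalue_vector n p e x v].

Definition complete_system (n : nat) (p : polyOn) (e : V) : Prop :=
  forall x : V, eigenvalues n p e x = 0 -> x = 0.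

Definition hyperbolicity_cone (n : nat) (p : polyOn) (e : V) : set V :=
  [set x | forall i, 0 <= eigenvalues n p e x i 0].

Definition open_hyperbolicity_cone (n : nat) (p : polyOn) (e : V) : set V :=
  [set x | forall i, 0 < eigenvalues n p e x i 0].

Definition rank_one (n : nat) (p : polyOn) (e c : V) : Prop :=
  #|[set i | eigenvalues n p e c i 0 != 0]%SET| = 1%N.

Definition pointed_cone (K : set V) : Prop :=
  forall x : V, K x -> K (- x) -> x = 0.

Definition extreme_direction (K : set V) (x : V) : Prop :=
  [/\ K x, x != 0
    & forall y z : V, K y -> K z -> y + z = x ->
        (exists2 a : R, 0 <= a & y = a *: x) /\
        (exists2 b : R, 0 <= b & z = b *: x)].

(* The element c generates the ray of x and satisfies
   lambda_1 c > 0 = lambda_2 c = ... = lambda_n c (indices start at 0). *)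
Definition rank_one_generator (n : nat) (p : polyOn) (e x c : V) : Prop :=
  [/\ exists2 a : R, 0 < a & x = a *: c,
      forall i : 'I_n, i = 0%N :> nat -> 0 < eigenvalues n p e c i 0
    & forall i : 'I_n, (0 < i)%N -> eigenvalues n p e c i 0 = 0].

Definition ROG_cone (n : nat) (p : polyOn) (e : V) : Prop :=
  pointed_cone (hyperbolicity_cone n p e) /\
  forall x : V, extreme_direction (hyperbolicity_cone n p e) x ->
    exists c : V, rank_one_generator n p e x c.

Definition scaled_Jordan_frame (n : nat) (p : polyOn) (e : V)
    (k : nat) (c : 'I_k -> V) : Prop :=
  (forall i, rank_one n p e (c i) /\ hyperbolicity_cone n p e (c i)) /\
  open_hyperbolicity_cone n p e (\sum_(i < k) c i).

End HyperbolicSystems.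

(* Hyperbolicity ensures that eigenvalues never takes its junk value. *)
Section EigenvaluesSpec.
Variables (R : realType) (V : vectType R).
Implicit Types (p : polyOn V) (e x : V).

Lemma size_coef_prod (I : Type) (s : seq I) (F : I -> {poly R})
    (d : I -> nat) (a : I -> R) :
  (forall i, (size (F i) <= (d i).+1)%N /\ (F i)`_(d i) = a i) ->
  (size (\prod_(i <- s) F i)%R <= (\sum_(i <- s) d i).+1)%N /\
  (\prod_(i <- s) F i)`_(\sum_(i <- s) d i) = \prod_(i <- s) a i.
Proof.
move=> H; elim: s => [|i s [IH1 IH2]]; first by rewrite !big_nil size_poly1 coefC.
rewrite !big_cons; have [H1 H2] := H i.
split.
  apply: leq_trans (size_polyMleq _ _) _.
  by rewrite -ltnS; apply: leq_trans (leqSpred _) _ => //; rewrite ltnS; move: (leq_add H1 IH1); rewrite addnS addSn; case: (_ + _)%N.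
have lt : (d i < (d i + \sum_(j <- s) d j).+1)%N by rewrite ltnS leq_addr.
rewrite coefM (bigD1 (Ordinal lt)) //= addKn H2 IH2 [X in _ + X]big1 ?addr0 // => k nk.
have {}nk : (k : nat) != d i by [].
case: (ltngtP k (d i)) nk => // h _.
  rewrite [X in _ * X]nth_default ?mulr0 //; apply: leq_trans IH1 _.
  move: (nat_of_ord k) h => k' h; set S := (\sum_(j <- s) d j)%N.
  by rewrite ltn_subRL ltn_add2r.
by rewrite nth_default ?mul0r //; apply: leq_trans H1 _.
Qed.

Lemma size_coef_pencil n p e x : p \is n.-homog ->
  (size (pencil p e x) <= n.+1)%N /\ (pencil p e x)`_n = peval p e.
Proof.
move=> /dhomogP hp.
pose L i : {poly R} := vcoord e i *: 'X - (vcoord x i)%:P.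
have key (m : 'X_{1.. \dim {:V}}) : m \in msupp p ->
  (size (mmap1 L m) <= n.+1)%N /\
  (mmap1 L m)`_n = mmap1 (vcoord e) m.
  move=> /hp mE; have {mE}<- : mdeg m = n := mE; rewrite mdegE; apply: size_coef_prod => i.
  have := @size_coef_prod _ (index_iota 0 (m i)) (fun=> L i) (fun=> 1%N) (fun=> vcoord e i).
  rewrite !prodr_const_nat sum_nat_const_nat subn0 muln1; apply => _; split.
    apply: leq_trans (size_polyD _ _) _; rewrite geq_max size_polyN.
    rewrite (leq_trans (size_scale_leq _ _)) ?size_polyX //=.
    by rewrite (leq_trans (size_polyC_leq1 _)).
  by rewrite coefB coefZ coefX coefC /= mulr1 subr0.
rewrite /pencil /mmap big_seq; split.
  apply: leq_trans (size_sum _ _ _) _; apply/bigmax_leqP_seq => m mp _.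
  rewrite mul_polyC; exact: leq_trans (size_scale_leq _ _) (key m mp).1.
rewrite coef_sum /peval /meval /mmap [RHS]big_seq; apply: eq_bigr => m mp.
by rewrite coefCM (key m mp).2.
Qed.

Lemma eigenvalues_spec n p e x : hyperbolic_system n p e ->
  is_eigenvalue_vector p e x (eigenvalues n p e x).
Proof.
case=> _ hom pe /(_ x) hr.
have [sz cf] := size_coef_pencil e x hom.
set P := pencil p e x in hr sz cf *.
have P0 : P != 0 by apply: contraNneq pe => P0; rewrite -cf P0 coef0.
have szP : size P = n.+1.
  apply/eqP; rewrite eqn_leq sz /= ltnNge; apply: contraNN pe => h.
  by rewrite -cf nth_default.
pose C := real_complex R.
have [r Pr] := closed_field_poly_normal (map_poly C P).
have rr z : z \in r -> z = C (complex.Re z).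
  move=> zr; have : root (map_poly C P) z.
    by rewrite Pr rootZ ?root_prod_XsubC // lead_coef_eq0 map_poly_eq0.
  by move/hr; case: z {zr} => a b /= ->.
pose s := sort >=%R (map (@complex.Re R) r).
have PE : P = lead_coef P *: \prod_(a <- s) ('X - a%:P).
  apply: (map_poly_inj C); rewrite Pr map_polyZ /= lead_coef_map; congr (_ *: _).
  rewrite rmorph_prod /=.
  rewrite (perm_big (map (@complex.Re R) r)) ?perm_sort //= big_map.
  rewrite big_seq [RHS]big_seq; apply: eq_bigr => z /rr zE.
  by rewrite {1}zE; symmetry; exact: map_polyXsubC.
have ss : size s = n.
  apply: succn_inj; rewrite -szP PE size_scale ?lead_coef_eq0 //.
  by rewrite size_prod_XsubC.
apply: (@xgetI _ _ _ (\col_i s`_i)); split=> [i j ij|a].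
  rewrite !mxE; have so : sorted >=%R s by apply: sort_sorted; move=> ? ?; exact: le_total.
  have tr : transitive (>=%R : rel R) by move=> y z t yz zt; exact: le_trans zt yz.
  have rf : reflexive (>=%R : rel R) by move=> y; exact: lexx.
  by apply: (sorted_leq_nth tr rf 0 so); rewrite // inE ss.
have -> : mup a (pencil p e x) = count_mem a s.
  rewrite -[pencil p e x]/P [in LHS]PE -mul_polyC mupMr ?mu_prod_XsubC //.
  by rewrite rootC lead_coef_eq0.
rewrite -[s in RHS](mkseq_nth 0) /mkseq ss -val_enum_ord -map_comp count_map.
rewrite -sum1_card -sum1_count enumT.
apply: eq_bigl => i.
by rewrite inE /= mxE.
Qed.
End EigenvaluesSpec.

(* Main.v *)
Require Import Defs.
From mathcomp Require Import all_boot all_order all_algebra.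
From mathcomp Require Import boolp classical_sets reals topology normedtype.
From mathcomp Require Import derive.
From mathcomp Require Import -(notations) mpoly.
From mathcomp Require Import ring lra.

Set Implicit Arguments.
Unset Strict Implicit.
Unset Printing Implicit Defensive.

Import Order.TTheory GRing.Theory Num.Theory numFieldNormedType.Exports.
Local Open Scope classical_set_scope.
Local Open Scope ring_scope.

(** The cone [K] of elements with nonnegative eigenvalues has a linear functional,
    the trace, that is positive on the nonzero elements of [K]: it is the sum of
    the eigenvalues ([trace_linear]), and it vanishes on [K] only at 0 by
    completeness ([trace_gt0]). Moreover [K] is closed, being the set of [x] with
    [t ^ n <= p (t e + x) / p e] for all [t >= 0] ([mem_coneP]), and it is stable
    under positive scaling.

    These properties suffice for a Krein-Milman statement up to closure: if a
    convex cone [N] contains all extreme directions of [K], then [K] is contained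
    in the closure of [N] ([extreme_directions_dense]). The reason is that the
    point of the slice of trace one that is farthest from a given point generates
    an extreme direction; choosing the given point far away in the direction
    opposite to a functional that separates [e] from [N] gives a contradiction.

    Apply this to the set [N] of sums of finite families of rank-one elements of
    [K], which contains the extreme directions because [K] is rank-one generated.
    Then [e] is in the closure of [N]. All elements near [e] have positive
    eigenvalues ([open_cone_nbhs]), so some element of [N] does; the family of
    rank-one elements of which it is the sum is a scaled Jordan frame. Topology is
    used in the coordinates of the basis of [V] in which [p] is written. *)

(** * Continuity of polynomial functions *)

Section RealFunctions.
Variables (R : realType) (T : topologicalType).

Lemma continuous_sum (I : Type) (r : seq I) (F : I -> T -> R) :
  (forall i, continuous (F i)) -> continuous (fun t => \sum_(i <- r) F i t).
Proof.
move=> cF; apply: (@continuous_big R I +%R 0 xpredT) => [|i _]; last exact: cF.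
exact: add_continuous.
Qed.

Lemma continuous_prod (I : Type) (r : seq I) (F : I -> T -> R) :
  (forall i, continuous (F i)) -> continuous (fun t => \prod_(i <- r) F i t).
Proof.
move=> cF; apply: (@continuous_big R I *%R 1 xpredT) => [|i _]; last exact: cF.
exact: mul_continuous.
Qed.

Lemma continuous_meval d (q : mpoly d R) (f : 'I_d -> T -> R) :
  (forall i, continuous (f i)) -> continuous (fun t => meval (f^~ t) q).
Proof.
move=> cf.
have cexp i k : continuous (fun t => f i t ^+ k).
  have -> : (fun t => f i t ^+ k) = (fun t => \prod_(j < k) f i t).
    by apply/funext => t; rewrite prodr_const card_ord.
  exact: continuous_prod.
apply: continuous_sum => m t.
apply: (@continuousM _ _ (fun=> mcoeff m q) (fun t => mmap1 (f^~ t) m)).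
  exact: cst_continuous.
by move: t; apply: continuous_prod => i; exact: cexp.
Qed.
End RealFunctions.

(** * Extreme directions of closed cones *)

Section ConeGeometry.
Variables (R : realType) (d : nat).
Implicit Types (u v w x y z : 'rV[R]_d) (K N A : set 'rV[R]_d).

Definition dot u v : R := \sum_i u 0 i * v 0 i.

Lemma dotC u v : dot u v = dot v u.
Proof. by apply: eq_bigr => i _; rewrite mulrC. Qed.

Lemma dotDl u v w : dot (u + v) w = dot u w + dot v w.
Proof. by rewrite -big_split; apply: eq_bigr => i _; rewrite mxE mulrDl. Qed.

Lemma dotZl (a : R) u v : dot (a *: u) v = a * dot u v.
Proof. by rewrite mulr_sumr; apply: eq_bigr => i _; rewrite mxE mulrA. Qed.

Lemma dotDr u v w : dot w (u + v) = dot w u + dot w v.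
Proof. by rewrite dotC dotDl !(dotC w). Qed.

Lemma dotZr (a : R) u v : dot v (a *: u) = a * dot v u.
Proof. by rewrite dotC dotZl dotC. Qed.

Lemma dotNl u v : dot (- u) v = - dot u v.
Proof. by rewrite -scaleN1r dotZl mulN1r. Qed.

Lemma dotNr u v : dot v (- u) = - dot v u.
Proof. by rewrite dotC dotNl dotC. Qed.

Lemma dot0l u : dot 0 u = 0.
Proof. by rewrite -(scale0r 0) dotZl mul0r. Qed.

Definition dotE := (dotDl, dotDr, dotNl, dotNr, dotZl, dotZr).

Lemma sqr_coord_le u i : u 0 i ^+ 2 <= dot u u.
Proof.
by rewrite /dot (bigD1 i) //= -expr2 lerDl; apply: sumr_ge0 => j _; exact: sqr_ge0.
Qed.

Lemma dot_ge0 u : 0 <= dot u u.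
Proof. by apply: sumr_ge0 => j _; exact: sqr_ge0. Qed.

Lemma dot_eq0 u : dot u u <= 0 -> u = 0.
Proof.
move=> u0; apply/rowP => i; rewrite mxE; apply/eqP; rewrite -sqrf_eq0 eq_le sqr_ge0.
by rewrite andbT (le_trans (sqr_coord_le u i)).
Qed.

Lemma dot_gt0 u : u != 0 -> 0 < dot u u.
Proof.
move=> u0; rewrite lt_neqAle dot_ge0 andbT; apply: contraNneq u0 => h.
by rewrite (dot_eq0 (u := u)) // -h.
Qed.

Lemma continuous_dot (T : topologicalType) (f g : T -> 'rV[R]_d) :
  continuous f -> continuous g -> continuous (fun t => dot (f t) (g t)).
Proof.
move=> cf cg; apply: continuous_sum => i t.
have coord (h : T -> 'rV[R]_d) : continuous h -> {for t, continuous (fun t => h t 0 i)}.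
  by move=> ch; apply: (@continuous_comp _ _ _ h (fun M : 'rV[R]_d => M 0 i));
    [exact: ch | exact: coord_continuous].
by apply: continuousM; exact: coord.
Qed.

Lemma continuous_dotl w : continuous (dot w).
Proof. by apply: continuous_dot => x; [exact: cst_continuous|exact: cvg_id]. Qed.

Lemma continuous_sqr : continuous (fun u => dot u u).
Proof. by apply: continuous_dot => x; exact: cvg_id. Qed.

Lemma closed_sqr_bounded_compact A (C : R) :
  closed A -> (forall u, A u -> dot u u <= C) -> compact A.
Proof.
move=> cA bA.
pose I : set R := `[- (C + 1), C + 1]%classic.
have cbox : compact [set u : 'rV[R]_d | forall i, I (u ord0 i)].
  by apply: (@rV_compact R d (fun=> I)) => i; exact: segment_compact.
apply: (subclosed_compact cA cbox) => u Au i /=.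
have := le_trans (sqr_coord_le u i) (bA u Au); rewrite /I /= in_itv /= => h.
by apply/andP; split; nra.
Qed.

(** By homogeneity it suffices to bound [dot w] below by a positive constant on
    the compact set of unit vectors of [K]. *)
Lemma bounded_cone_slice K w : closed K ->
  (forall x (a : R), 0 < a -> K x -> K (a *: x)) ->
  (forall x, K x -> x != 0 -> 0 < dot w x) ->
  exists2 C : R, 0 < C & forall x, K x -> dot w x = 1 -> dot x x <= C.
Proof.
move=> cK sK pK.
have cw : continuous (fun x => dot w x) := @continuous_dotl w.
have csq : continuous (fun x => dot x x) := continuous_sqr.
pose S := K `&` [set x | dot x x = 1].
have cS : compact S.
  apply: (@closed_sqr_bounded_compact _ 1) => [|u [_ ->] //].
  apply: closedI => //.
  exact: (preimage_closed (fun x _ => csq x) (@closed_eq _ 1)).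
have normalize x : K x -> x != 0 -> S ((Num.sqrt (dot x x))^-1 *: x).
  move=> Kx x0.
  have xx := dot_gt0 x0.
  have sx : 0 < Num.sqrt (dot x x) by rewrite sqrtr_gt0.
  split; first by apply: sK; rewrite ?invr_gt0.
  rewrite /= dotZl dotZr mulrA -invfM -expr2 sqr_sqrtr ?dot_ge0 // mulVf //.
  by rewrite gt_eqF.
have [S0|S0] := pselect (S !=set0); last first.
  exists 1 => // x Kx _; have [->|x0] := eqVneq x 0; first by rewrite dot0l.
  by case: S0; exists ((Num.sqrt (dot x x))^-1 *: x); exact: normalize.
have [c] := compact_EVT_min S0 cS (continuous_subspaceT cw).
rewrite inE => -[Kc /= c1] cmin.
have m0 : 0 < dot w c.
  apply: pK => //; apply/eqP => c0; move: c1; rewrite c0 dot0l => /eqP.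
  by rewrite eq_sym oner_eq0.
exists ((dot w c) ^- 2) => [|x Kx wx]; first by rewrite invr_gt0 exprn_gt0.
have [->|x0] := eqVneq x 0; first by rewrite dot0l invr_ge0 exprn_ge0 // ltW.
have := cmin _ (mem_set (normalize x Kx x0)); rewrite dotZr wx mulr1.
have := dot_gt0 x0; set s := dot x x => s0.
have r0 : 0 < Num.sqrt s by rewrite sqrtr_gt0.
rewrite -[(Num.sqrt s)^-1]mul1r ler_pdivlMr // => h.
rewrite -[s]sqr_sqrtr ?(ltW s0) // -(ler_pM2r (exprn_gt0 2 m0)).
rewrite mulVf ?gt_eqF ?exprn_gt0 //.
by rewrite -exprMn mulrC expr_le1 // mulr_ge0 // ?ltW.
Qed.

(** The normal is [v = e - y0], where [y0] is the point of the closure of [N]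
    nearest to [e]. Moving [y0] towards [y0 + s] and towards [0] stays in the
    closure, so the first-order conditions at the minimum are
    [dot v s <= 0] and [dot v y0 >= 0]; hence [dot v e >= dot v v > 0]. *)
Lemma convex_cone_separation N e : N 0 ->
  (forall x (a : R), 0 <= a -> N x -> N (a *: x)) ->
  (forall x y, N x -> N y -> N (x + y)) ->
  ~ closure N e ->
  exists2 v, (forall s, N s -> dot v s <= 0) & 0 < dot v e.
Proof.
move=> N0 sN aN Ne.
have cd : continuous (fun y => dot (e - y) (e - y)).
  have : continuous (fun y => e - y).
    by move=> y; apply: (@continuousB R 'rV[R]_d 'rV[R]_d (fun=> e) id);
      [exact: cst_continuous|exact: cvg_id].
  by move=> h; exact: continuous_dot.
have clmap (f : 'rV[R]_d -> 'rV[R]_d) : continuous f -> (forall y, N y -> N (f y)) ->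
    forall y, closure N y -> closure N (f y).
  move=> cf Nf y Ny B /cf /Ny [z [Nz Bz]].
  by exists (f z); split => //; exact: Nf.
(* Only points at distance at most |e| from e compete with the point 0; by the
   triangle inequality they have norm at most 2 |e|. *)
pose A := closure N `&` [set y | dot (e - y) (e - y) <= dot e e].
have cA : compact A.
  apply: (@closed_sqr_bounded_compact _ (4 * dot e e)) => [|y [_ /=]].
    apply: closedI; first exact: closed_closure.
    exact: (preimage_closed (fun x _ => cd x) (@closed_le _ (dot e e))).
  move=> h; have := dot_ge0 (2 *: e - y); move: h; rewrite !dotE (dotC y e); lra.
have A0 : A 0 by split=> /=; [exact: subset_closure | rewrite subr0].
have [y0] := compact_EVT_min (ex_intro _ _ A0) cA (continuous_subspaceT cd).
rewrite inE => -[Ny0 /= y0e] ymin.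
have min y : closure N y -> dot (e - y0) (e - y0) <= dot (e - y) (e - y).
  move=> Ny; have [h|/ltW h] := leP (dot (e - y) (e - y)) (dot e e).
    by apply: ymin; rewrite inE; split.
  exact: le_trans h.
have [v vE] : {v | v = e - y0} by exists (e - y0).
have small (b c : R) : 0 <= c ->
    (forall t, 0 < t -> t <= 1 -> 2 * b <= t * c) -> b <= 0.
  move=> c0 H; rewrite leNgt; apply/negP => b0.
  have bc : 0 < b + c by lra.
  (* The step t = b / (b + c) makes t * c smaller than b. *)
  have : 2 * b <= b / (b + c) * c.
    by apply: H; [exact: divr_gt0 | rewrite ler_pdivrMr // mul1r; lra].
  rewrite mulrAC ler_pdivlMr //; nra.
(* First-order condition in an admissible direction z. *)
have opt z : (forall t : R, 0 < t -> t <= 1 -> closure N (y0 + t *: z)) -> dot v z <= 0.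
  move=> H; apply: (small _ (dot z z) (dot_ge0 z)) => t t0 t1.
  have := min _ (H t t0 t1).
  have -> : e - (y0 + t *: z) = v - t *: z by rewrite vE opprD addrA.
  rewrite -vE !dotE (dotC z v) => h.
  rewrite -(ler_pM2l t0); move: h; lra.
exists v => [s Ns|].
  apply: opt => t t0 _; apply: (clmap (fun y => y + t *: s)) => // y.
    by apply: (@continuousD R 'rV[R]_d 'rV[R]_d id (fun=> t *: s));
      [exact: cvg_id|exact: cst_continuous].
  by move=> Ny; apply: aN => //; apply: sN => //; exact: ltW.
have v0 : v != 0.
  by apply/eqP => v0; apply: Ne; rewrite -[e](subrK y0) -vE v0 add0r.
have : dot v (- y0) <= 0.
  apply: opt => t t0 t1; rewrite scalerN -{1}[y0]scale1r -scalerBl.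
  apply: (clmap (fun y => (1 - t) *: y)) => // y.
    exact: scaler_continuous.
  by apply: sN; lra.
have -> : e = v + y0 by rewrite vE subrK.
have := dot_gt0 v0; rewrite !dotE; lra.
Qed.

(** A Straszewicz-type argument. If [e] were outside the closure of [N],
    separate it from [N] by [v] and maximize
    [f x = |x|^2 + 2 M (v, x)] over the compact slice [dot w x = 1] of [K], that
    is, take the point of the slice farthest from [- M v]. Since [f] is strictly
    convex, a maximizer [x] cannot split as a sum of two elements of [K] that are
    not multiples of [x]; hence it is extreme, lies in [N], and [dot v x <= 0].
    So [f x] is at most the bound [C] of the squared norm on the slice, whereas
    for [M] large the multiple of [e] in the slice has a larger value. *)
Lemma extreme_directions_dense K N w : closed K ->
  (forall x (a : R), 0 < a -> K x -> K (a *: x)) ->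
  (forall x, K x -> x != 0 -> 0 < dot w x) ->
  N 0 ->
  (forall x (a : R), 0 <= a -> N x -> N (a *: x)) ->
  (forall x y, N x -> N y -> N (x + y)) ->
  (forall x, extreme_direction K x -> N x) ->
  K `<=` closure N.
Proof.
move=> cK sK pK N0 sN aN exN e Ke.
have [e0|e0] := eqVneq e 0; first by rewrite e0; exact: subset_closure.
have [//|Ne] := pselect (closure N e).
have [v vN ve] := convex_cone_separation N0 sN aN Ne.
have [C C0 HC] := bounded_cone_slice cK sK pK.
have cw u : continuous (fun x => dot u x) := @continuous_dotl u.
have csq : continuous (fun x => dot x x) := continuous_sqr.
pose B := K `&` [set x | dot w x = 1].
have cB : compact B.
  apply: (@closed_sqr_bounded_compact _ C) => [|u [Ku /= wu]]; last exact: HC.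
  apply: closedI => //.
  exact: (preimage_closed (fun x _ => cw w x) (@closed_eq _ 1)).
have we := pK e Ke e0.
have toB x : K x -> 0 < dot w x -> B ((dot w x)^-1 *: x).
  move=> Kx wx; split; first by apply: sK; rewrite ?invr_gt0.
  by rewrite /= dotZr mulVf // gt_eqF.
(* With this M the point e / dot w e of the slice has f-value at least 2 C. *)
pose M := C * dot w e / dot v e.
pose f x := dot x x + dot ((2 * M) *: v) x.
have cf : continuous f.
  move=> x; apply: (@continuousD R R^o 'rV[R]_d (fun y => dot y y) (dot _)).
    exact: csq.
  exact: cw.
have [x] := compact_EVT_max (ex_intro _ _ (toB e Ke we)) cB (continuous_subspaceT cf).
rewrite inE => -[Kx /= wx] xmax.
have M0 : 0 < M by rewrite divr_gt0 // mulr_gt0.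
have : f ((dot w e)^-1 *: e) <= f x by apply: xmax; rewrite inE; exact: toB.
suff Nx : N x.
  rewrite /f [in X in X <= _](_ : dot (_ *: v) _ = 2 * C); last first.
    by rewrite dotZl dotZr /M; field; rewrite !gt_eqF.
  have := HC x Kx wx; have := dot_ge0 ((dot w e)^-1 *: e).
  rewrite [dot (_ *: v) x]dotZl.
  have := vN x Nx; nra.
apply: exN; split=> // [|y z Ky Kz yzx].
  by apply/eqP => x0; move: wx; rewrite x0 dotC dot0l => /eqP; rewrite eq_sym oner_eq0.
have [y0|yn0] := eqVneq y 0.
  split; [exists 0 | exists 1] => //; first by rewrite scale0r.
  by rewrite scale1r -yzx y0 add0r.
have [z0|zn0] := eqVneq z 0.
  split; [exists 1 | exists 0] => //; last by rewrite scale0r.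
  by rewrite scale1r -yzx z0 addr0.
set a := dot w y; set b := dot w z.
have a0 : 0 < a by exact: pK. have b0 : 0 < b by exact: pK.
have ab : a + b = 1 by rewrite -wx -yzx dotDr.
have [y' By' yE] : exists2 y', B y' & y = a *: y'.
  by exists (a^-1 *: y); rewrite ?scalerA ?divff ?scale1r ?gt_eqF //; exact: toB.
have [z' Bz' zE] : exists2 z', B z' & z = b *: z'.
  by exists (b^-1 *: z); rewrite ?scalerA ?divff ?scale1r ?gt_eqF //; exact: toB.
have fy : f y' <= f x by apply: xmax; rewrite inE.
have fz : f z' <= f x by apply: xmax; rewrite inE.
(* The defect in the convexity inequality for f at x = a y' + b z'. *)
have fx : f x = a * f y' + b * f z' - a * b * dot (y' - z') (y' - z').
  rewrite -yzx yE zE /f !dotE (dotC z' y').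
  have -> : b = 1 - a by lra. ring.
have yz' : y' = z'.
  apply/eqP; rewrite -subr_eq0; apply/eqP/dot_eq0.
  rewrite -(pmulr_rle0 _ (mulr_gt0 a0 b0)).
  have := ler_wpM2l (ltW a0) fy; have := ler_wpM2l (ltW b0) fz.
  have : (a + b) * f x = f x by rewrite ab mul1r.
  lra.
have xE : x = y' by rewrite -yzx yE zE -yz' -scalerDl ab scale1r.
by split; [exists a | exists b]; rewrite ?ltW ?xE // zE -yz'.
Qed.

End ConeGeometry.

(** * Univariate polynomials *)

Section Polynomials.
Variable R : numFieldType.

Lemma poly_horner_inj (P Q : {poly R}) : (forall t, P.[t] = Q.[t]) -> P = Q.
Proof.
move=> PQ; apply/eqP; rewrite -subr_eq0; apply/eqP.
apply: (@roots_geq_poly_eq0 _ _ [seq i%:R | i <- iota 0 (size (P - Q))]).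
- by apply/allP => t _; rewrite rootE !hornerE PQ subrr.
- by rewrite map_inj_uniq ?iota_uniq // => i j /eqP; rewrite eqr_nat => /eqP.
- by rewrite size_map size_iota.
Qed.

Lemma prod_XsubC_dvdp (s : seq R) (q : {poly R}) : q != 0 ->
  (forall a, count_mem a s <= mup a q)%N -> \prod_(a <- s) ('X - a%:P) %| q.
Proof.
elim: s q => [|b s IH] q q0 sq; first by rewrite big_nil dvd1p.
have : 'X - b%:P %| q by rewrite XsubC_dvd //; apply: leq_trans (sq b); rewrite /= eqxx.
move=> /dvdpP [r qE]; rewrite big_cons qE mulrC dvdp_mul2r ?polyXsubC_eq0 //.
move: q0 sq; rewrite qE mulf_eq0 negb_or => /andP[r0 b0] sq.
apply: IH => // a; have := sq a.
have -> : mup a (r * ('X - b%:P)) = (mup a r + (b == a))%N.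
  by rewrite mupM //; congr (_ + _)%N; rewrite -['X - _]expr1 mup_XsubCX; case: eqP.
by rewrite /= addnC leq_add2r.
Qed.

Lemma count_map_enum (T : eqType) (I : finType) (f : I -> T) (a : T) :
  count_mem a [seq f i | i <- enum I] = #|[set i | f i == a]%SET|.
Proof.
by rewrite count_map -sum1_card -sum1_count enumT; apply: eq_bigl => i; rewrite inE.
Qed.

Lemma coef1_prod_lin (n : nat) (l : 'I_n -> R) :
  (\prod_i (1 + l i *: 'X))`_1 = \sum_i l i.
Proof.
pose good (P : {poly R}) (a : R) := P`_0 = 1 /\ P`_1 = a.
suff [] : good (\prod_i (1 + l i *: 'X)) (\sum_i l i) by [].
apply: (big_rec2 good) => [|i P a _ [P0 P1]]; first by rewrite /good !coef1.
rewrite /good !coefM !big_ord_recl big_ord0 /= !coefD !coefZ !coefX !coef1 /= P0 P1.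
by rewrite !big_ord0; split; ring.
Qed.

End Polynomials.

(** * First-order expansion of a polynomial along lines *)

Section FirstOrder.
Variables (R : realType) (d : nat).
Implicit Types (b w : 'rV[R]_d) (F G : 'rV[R]_d -> {poly R}).

(** Along the line [a + t b] the term of order zero of a polynomial function is
    independent of [b], and the term of order one is linear in [b]. This property
    of families of polynomials in [t] is stable under sums and products, so it
    is inherited from the coordinate functions by every polynomial. *)
Definition affine_mod_X2 F :=
  exists c w, forall b, (F b)`_0 = c /\ (F b)`_1 = dot w b.

Lemma affine_mod_X2_const (q : {poly R}) : q`_1 = 0 -> affine_mod_X2 (fun=> q).
Proof. by move=> q1; exists q`_0, 0 => b; rewrite dot0l. Qed.

Lemma affine_mod_X2D F G : affine_mod_X2 F -> affine_mod_X2 G ->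
  affine_mod_X2 (fun b => F b + G b).
Proof.
move=> [c [w Fc]] [c' [w' Gc]]; exists (c + c'), (w + w') => b.
by rewrite !coefD dotDl; have [-> ->] := Fc b; have [-> ->] := Gc b.
Qed.

Lemma affine_mod_X2M F G : affine_mod_X2 F -> affine_mod_X2 G ->
  affine_mod_X2 (fun b => F b * G b).
Proof.
move=> [c [w Fc]] [c' [w' Gc]]; exists (c * c'), (c *: w' + c' *: w) => b.
rewrite !coefM !big_ord_recl !big_ord0 /= dotDl !dotZl.
by have [-> ->] := Fc b; have [-> ->] := Gc b; split; ring.
Qed.

Definition line_poly (p : mpoly d R) (a : 'I_d -> R) b : {poly R} :=
  mmap (@polyC R) (fun i => (a i)%:P + b 0 i *: 'X) p.

Lemma horner_line_poly p a b t :
  (line_poly p a b).[t] = meval (fun i => a i + t * b 0 i) p.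
Proof.
rewrite /line_poly /meval /mmap horner_sum; apply: eq_bigr => m _.
rewrite hornerM hornerC /mmap1 horner_prod; congr (_ * _).
by apply: eq_bigr => i _; rewrite horner_exp !hornerE mulrC.
Qed.

Lemma line_poly_affine p a : affine_mod_X2 (line_poly p a).
Proof.
have sumP (I : Type) (s : seq I) (F : I -> 'rV[R]_d -> {poly R}) :
    (forall i, affine_mod_X2 (F i)) -> affine_mod_X2 (fun b => \sum_(i <- s) F i b).
  move=> H; elim: s => [|i s IH].
    by under eq_fun do rewrite big_nil; apply: affine_mod_X2_const; rewrite coef0.
  by under eq_fun do rewrite big_cons; exact: affine_mod_X2D.
have prodP (I : Type) (s : seq I) (F : I -> 'rV[R]_d -> {poly R}) :
    (forall i, affine_mod_X2 (F i)) -> affine_mod_X2 (fun b => \prod_(i <- s) F i b).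
  move=> H; elim: s => [|i s IH].
    by under eq_fun do rewrite big_nil; apply: affine_mod_X2_const; rewrite coef1.
  by under eq_fun do rewrite big_cons; exact: affine_mod_X2M.
apply: sumP => m; apply: affine_mod_X2M.
  by apply: affine_mod_X2_const; rewrite coefC.
apply: prodP => i.
elim: (fun_of_multinom m i) => [|k IH].
  by under eq_fun do rewrite expr0; apply: affine_mod_X2_const; rewrite coef1.
under eq_fun do rewrite exprS; apply: affine_mod_X2M IH.
exists (a i), (delta_mx 0 i) => b; rewrite !coefD !coefZ !coefX !coefC /= mulr0 mulr1.
rewrite addr0 add0r; split => //.
rewrite /dot (bigD1 i) //= mxE !eqxx mul1r big1 ?addr0 // => j ji.
by rewrite mxE (negPf ji) andbF mul0r.
Qed.

End FirstOrder.

(** * Eigenvalues, the hyperbolicity cone and the trace *)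

Section HyperbolicCone.
Variables (R : realType) (V : vectType R) (n : nat) (p : polyOn V) (e : V).
Hypothesis hyp : hyperbolic_system n p e.
Implicit Types (x y z c : V).

Local Notation lam x i := (eigenvalues n p e x i 0).
Local Notation K := (hyperbolicity_cone n p e).

Lemma vcoordD x y i : vcoord (x + y) i = vcoord x i + vcoord y i.
Proof. exact: linearD. Qed.

Lemma vcoordZ a x i : vcoord (a *: x) i = a * vcoord x i.
Proof. exact: linearZ. Qed.

Lemma peval_homog a x : peval p (a *: x) = a ^+ n * peval p x.
Proof.
have [_ /dhomogP hom _ _] := hyp.
rewrite /peval !mevalE mulr_sumr big_seq [RHS]big_seq; apply: eq_bigr => m /hom mn.
rewrite mulrCA; congr (_ * _).
under eq_bigr do rewrite vcoordZ exprMn.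
rewrite big_split /=; congr (_ * _).
by rewrite prodrXr -mdegE; congr (_ ^+ _).
Qed.

(** The eigenvalue vector lists the roots of the pencil with their
    multiplicities, and there are as many of them as its degree. *)
Lemma pencil_factor x :
  pencil p e x = peval p e *: \prod_i ('X - (lam x i)%:P).
Proof.
have [_ hom pe _] := hyp; have [_ mult] := eigenvalues_spec x hyp.
have [sz lead] := size_coef_pencil e x hom.
set q := pencil p e x in mult sz lead *; pose s := [seq lam x i | i <- enum 'I_n].
have q0 : q != 0 by apply: contraNneq pe => q0; rewrite -lead q0 coef0.
have szq : size q = n.+1.
  apply/eqP; rewrite eqn_leq sz ltnNge; apply: contraNN pe => /(nth_default 0).
  by rewrite lead => ->.
have prodE : \prod_i ('X - (lam x i)%:P) = \prod_(a <- s) ('X - a%:P).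
  by rewrite big_map big_enum.
have dv : \prod_(a <- s) ('X - a%:P) %| q.
  by apply: prod_XsubC_dvdp => // a; rewrite -mult count_map_enum.
have szs : size (\prod_(a <- s) ('X - a%:P)) = size q.
  by rewrite szq size_prod_XsubC size_map size_enum_ord.
have := dvdp_size_eqp dv; rewrite szs eqxx => /esym /eqp_eq.
have -> : lead_coef (\prod_(a <- s) ('X - a%:P)) = 1.
  by apply/monicP; exact: monic_prod_XsubC.
by rewrite scale1r prodE lead_coefE szq /= lead.
Qed.

Lemma peval_plane u s x :
  peval p (u *: e + s *: x) = peval p e * \prod_i (u + s * lam x i).
Proof.
have [->|s0] := eqVneq s 0.
  rewrite scale0r addr0 peval_homog mulrC; congr (_ * _).
  by under eq_bigr do rewrite mul0r addr0; rewrite prodr_const card_ord.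
have -> : u *: e + s *: x = (- s) *: ((- (u / s)) *: e - x).
  rewrite scalerBr scalerA scaleNr opprK; congr (_ *: _ + _).
  by field.
rewrite peval_homog -horner_pencil pencil_factor hornerZ mulrCA; congr (_ * _).
rewrite horner_prod -[n in _ ^+ n]card_ord -prodr_const -big_split /=.
by apply: eq_bigr => i _; rewrite !hornerE; field.
Qed.

(** Since [p (t e + x) / p e] is the product of the [t + lambda_i x], the
    condition [lambda x >= 0] bounds it below by [t ^ n] for [t >= 0], and a
    negative [lambda_i x] makes it vanish at [t = - lambda_i x > 0]. Each of
    these bounds is a closed condition on [x]. *)
Lemma mem_coneP x : K x <->
  forall t, 0 <= t -> t ^+ n <= peval p (t *: e + x) / peval p e.
Proof.
have [_ _ pe _] := hyp.
have pE t : peval p (t *: e + x) / peval p e = \prod_i (t + lam x i).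
  rewrite -[x in LHS]scale1r peval_plane mulrC mulKf //.
  by apply: eq_bigr => i _; rewrite mul1r.
split=> [Kx t t0|H i].
  rewrite pE -[n in _ ^+ n]card_ord -prodr_const; apply: ler_prod => i _.
  by rewrite t0 lerDl; exact: Kx.
rewrite leNgt; apply/negP => l0.
have := H (- lam x i); rewrite pE (bigD1 i) //= addNr mul0r oppr_ge0 => /(_ (ltW l0)).
by rewrite leNgt exprn_gt0 // oppr_gt0.
Qed.

Lemma mem_open_cone x : (forall t, 0 <= t -> peval p (t *: e + x) != 0) ->
  open_hyperbolicity_cone n p e x.
Proof.
move=> H i; rewrite ltNge; apply/negP => l0.
have := H (- lam x i); rewrite oppr_ge0 => /(_ l0).
rewrite -[x in _ + x]scale1r peval_plane.
by rewrite (bigD1 i) //= mul1r addNr mul0r mulr0 eqxx.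
Qed.

Lemma cone_scale a x : 0 < a -> K x -> K (a *: x).
Proof.
move=> a0 /mem_coneP Kx; apply/mem_coneP => t t0.
have -> : t *: e + a *: x = a *: ((t / a) *: e + x).
  by rewrite scalerDr scalerA mulrCA divff ?mulr1 // gt_eqF.
rewrite peval_homog -mulrA -[t in t ^+ n](divfK (lt0r_neq0 a0)) exprMn mulrC.
rewrite ler_pM2l ?exprn_gt0 //; apply: Kx.
by rewrite divr_ge0 // ltW.
Qed.

(** The number of zero eigenvalues is the multiplicity of the root [0] of the
    pencil, whose other roots are scaled by [a]. *)
Lemma rank_one_scale a x : 0 < a -> rank_one n p e x -> rank_one n p e (a *: x).
Proof.
move=> a0; rewrite /rank_one => rx; apply: etrans rx.
have card0 y : #|[set i | lam y i != 0]%SET| = (n - #|[set i | lam y i == 0%R]%SET|)%N.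
  have := cardsC [set i | lam y i == 0]%SET; rewrite card_ord => h.
  apply: etrans (congr1 (subn^~ #|[set i | lam y i == 0]%SET|) h); rewrite addKn.
  by apply: eq_card => i; rewrite !inE.
rewrite !card0; congr (_ - _)%N.
have [_ ->] := eigenvalues_spec (a *: x) hyp.
have -> : pencil p e (a *: x) =
    peval p e *: \prod_(b <- [seq a * lam x i | i <- enum 'I_n]) ('X - b%:P).
  apply: poly_horner_inj => t; rewrite horner_pencil -scaleNr peval_plane.
  rewrite hornerZ big_map big_enum /= horner_prod; congr (_ * _).
  by apply: eq_bigr => i _; rewrite !hornerE mulNr.
have [_ _ pe _] := hyp.
rewrite -mul_polyC mupMr ?rootC // mu_prod_XsubC count_map_enum; apply: eq_card => i.
by rewrite !inE /= mulf_eq0 gt_eqF.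
Qed.

(** The trace is the coefficient of [t] in
    [p (e + t x) / p e = \prod_i (1 + t lambda_i x)]. *)
Lemma trace_linear :
  exists w : 'rV[R]_(\dim {:V}), forall x, \sum_i lam x i = dot w (\row_j vcoord x j).
Proof.
have [_ _ pe _] := hyp.
have [c [w Hw]] := line_poly_affine p (vcoord e).
exists ((peval p e)^-1 *: w) => x; rewrite dotZl -(Hw _).2.
have -> : line_poly p (vcoord e) (\row_j vcoord x j) =
          peval p e *: \prod_i (1 + lam x i *: 'X).
  apply: poly_horner_inj => t.
  rewrite horner_line_poly hornerZ horner_prod.
  have := peval_plane 1 t x; rewrite scale1r.
  under [in X in _ = X]eq_bigr do rewrite mulrC.
  have -> : \prod_i (1 + lam x i *: 'X).[t] = \prod_i (1 + lam x i * t).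
    by apply: eq_bigr => i _; rewrite !hornerE.
  move=> <-; apply: meval_eq => i.
  by rewrite mxE vcoordD vcoordZ.
by rewrite coefZ coef1_prod_lin mulKf.
Qed.

Lemma trace_gt0 x : complete_system n p e -> K x -> x != 0 -> 0 < \sum_i lam x i.
Proof.
move=> complete Kx; rewrite lt_neqAle sumr_ge0 ?andbT // => x0.
apply: contraNneq x0 => s0; apply/eqP; apply: complete; apply/colP => i; rewrite mxE.
by have /eqP := esym s0; rewrite psumr_eq0 // => /allP /(_ i (mem_index_enum _)) /eqP.
Qed.

Lemma rank_one_generator_mem x c : (0 < n)%N -> rank_one_generator n p e x c ->
  rank_one n p e x /\ K x.
Proof.
move=> n0 [[a a0 ->] c0 cS].
suff [rc Kc] : rank_one n p e c /\ K c.
  by split; [exact: rank_one_scale|exact: cone_scale].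
split=> [|i]; last by have [/c0/ltW //|/cS ->] := posnP i.
apply: etrans (cards1 (Ordinal n0)); apply: eq_card => i; rewrite !inE.
have [i0|i0] := posnP i.
  by rewrite gt_eqF ?c0 //; symmetry; apply/eqP/val_inj.
by rewrite cS // eqxx; symmetry; apply/negbTE; apply: contraTneq i0 => ->.
Qed.

End HyperbolicCone.

(** * Coordinates *)

Section Coordinates.
Variables (R : realType) (V : vectType R).
Local Notation d := (\dim {:V}).

Definition of_coords (u : 'rV[R]_d) : V := \sum_i u 0 i *: (vbasis {:V})`_i.

Definition to_coords (x : V) : 'rV[R]_d := \row_i vcoord x i.

Lemma of_coordsK : cancel of_coords to_coords.
Proof.
move=> u; apply/rowP => i; rewrite mxE.
by apply: coord_sum_free; exact: basis_free (vbasisP _).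
Qed.

Lemma to_coordsK : cancel to_coords of_coords.
Proof.
move=> x; rewrite [RHS](coord_vbasis (memvf x)).
by apply: eq_bigr => i _; rewrite mxE.
Qed.

Lemma of_coordsD u v : of_coords (u + v) = of_coords u + of_coords v.
Proof. by rewrite -big_split; apply: eq_bigr => i _; rewrite mxE scalerDl. Qed.

Lemma of_coordsZ a u : of_coords (a *: u) = a *: of_coords u.
Proof. by rewrite scaler_sumr; apply: eq_bigr => i _; rewrite mxE scalerA. Qed.

Lemma of_coords0 : of_coords 0 = 0.
Proof. by rewrite -(scale0r 0) of_coordsZ scale0r. Qed.

Lemma continuous_peval (p : polyOn V) (x : V) :
  continuous (fun u => peval p (x + of_coords u)).
Proof.
have -> : (fun u => peval p (x + of_coords u)) =
          (fun u => meval (fun i => vcoord x i + u 0 i) p).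
  apply/funext => u; apply: meval_eq => i; rewrite vcoordD; congr (_ + _).
  by rewrite -[in RHS](of_coordsK u) mxE.
apply: (@continuous_meval _ _ _ _ (fun i (u : 'rV[R]_d) => vcoord x i + u 0 i)) => i u.
apply: (@continuousD R R^o 'rV[R]_d (fun=> vcoord x i) (fun u : 'rV[R]_d => u 0 i)).
  exact: cst_continuous.
exact: coord_continuous.
Qed.

End Coordinates.

(** * Sums of rank-one elements *)

Section Frames.
Variables (R : realType) (V : vectType R) (n : nat) (p : polyOn V) (e : V).
Hypothesis hyp : hyperbolic_system n p e.
Local Notation d := (\dim {:V}).
Local Notation K := (hyperbolicity_cone n p e).

Definition coords_cone : set 'rV[R]_d := [set u | K (of_coords u)].

(** Coordinate vectors of the sums of finite families of rank-one elements of
    the cone. Families may be empty, so this is a convex cone containing 0. *)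
Definition rank_one_sums : set 'rV[R]_d :=
  [set u | exists (k : nat) (c : 'I_k -> V),
     (forall i, rank_one n p e (c i) /\ K (c i)) /\ of_coords u = \sum_i c i].

Lemma closed_coords_cone : closed coords_cone.
Proof.
have -> : coords_cone = \bigcap_(t in [set t : R | 0 <= t])
    [set u | t ^+ n <= peval p (t *: e + of_coords u) / peval p e].
  by apply/seteqP; split=> u /=; rewrite /coords_cone /= (mem_coneP hyp).
apply: closed_bigI => t _.
have cq : continuous (fun u => peval p (t *: e + of_coords u) / peval p e).
  move=> u; apply: (@continuousM _ _ (fun u => peval p (t *: e + of_coords u))
    (fun=> (peval p e)^-1)).
    exact: continuous_peval.
  exact: cst_continuous.
exact: (preimage_closed (fun u _ => cq u) (@closed_ge _ (t ^+ n))).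
Qed.

Lemma rank_one_sums0 : rank_one_sums 0.
Proof. by exists 0%N, (fun=> 0); split=> [[]//|]; rewrite of_coords0 big_ord0. Qed.

Lemma rank_one_sumsD u v :
  rank_one_sums u -> rank_one_sums v -> rank_one_sums (u + v).
Proof.
move=> [k [c [Hc uE]]] [l [c' [Hc' vE]]].
pose cc (i : 'I_k + 'I_l) := match i with inl j => c j | inr j => c' j end.
exists (k + l)%N, (cc \o @split k l).
split=> [i|]; first by rewrite /= /cc; case: split.
rewrite of_coordsD uE vE big_split_ord /=; congr (_ + _); apply: eq_bigr => i _.
  by rewrite -[lshift l i]/(unsplit (inl i)) unsplitK.
by rewrite -[rshift k i]/(unsplit (inr i)) unsplitK.
Qed.

Lemma rank_one_sumsZ u a : 0 <= a -> rank_one_sums u -> rank_one_sums (a *: u).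
Proof.
rewrite le_eqVlt => /predU1P[<- _|a0 [k [c [Hc uE]]]].
  by rewrite scale0r; exact: rank_one_sums0.
exists k, (fun i => a *: c i); split=> [i|]; last by rewrite of_coordsZ uE scaler_sumr.
by have [rc Kc] := Hc i; split; [exact: rank_one_scale|exact: cone_scale].
Qed.

Lemma extreme_rank_one u : (0 < n)%N -> ROG_cone n p e ->
  extreme_direction coords_cone u -> rank_one_sums u.
Proof.
move=> n0 [_ rog] [Ku u0 ext].
have [|c /(rank_one_generator_mem hyp n0) rK] := rog (of_coords u).
  split=> [//||y z Ky Kz yz].
    by apply: contraNneq u0 => h; rewrite -(of_coordsK u) h -of_coords0 of_coordsK.
  have := ext (to_coords y) (to_coords z).
  rewrite /coords_cone /= !to_coordsK => /(_ Ky Kz) [|[a a0 ya] [b b0 zb]].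
    by rewrite -[LHS]of_coordsK -[RHS]of_coordsK of_coordsD !to_coordsK yz.
  split; [exists a => // | exists b => //].
    by rewrite -[y]to_coordsK ya of_coordsZ.
  by rewrite -[z]to_coordsK zb of_coordsZ.
by exists 1%N, (fun=> of_coords u); rewrite big_ord1.
Qed.

(** If [p] has no zero in the ball of radius [r] about [e], and [u] lies in this
    ball, then [p (t e + u)] is nonzero for [t >= 0], because
    [(t e + u) / (1 + t)] is in the ball too. *)
Lemma open_cone_nbhs :
  nbhs (to_coords e) [set u | open_hyperbolicity_cone n p e (of_coords u)].
Proof.
have [_ _ pe _] := hyp.
have cp : continuous (fun u => peval p (of_coords u)).
  by under eq_fun do rewrite -[of_coords _]add0r; exact: continuous_peval.
have : nbhs (to_coords e) [set u | peval p (of_coords u) != 0].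
  apply: (cp (to_coords e) [set s | s != 0]).
  by apply: open_nbhs_nbhs; split; [exact: open_neq|rewrite /= to_coordsK].
move=> /(@nbhs_normP R 'rV[R]_d (to_coords e)) [r r0 near0].
apply/(@nbhs_normP R 'rV[R]_d (to_coords e)); exists r => // u /= ur.
apply: (mem_open_cone hyp) => t t0.
have t1 : 0 < 1 + t by rewrite ltr_wpDr.
have -> : t *: e + of_coords u =
    (1 + t) *: of_coords (to_coords e + (1 + t)^-1 *: (u - to_coords e)).
  rewrite of_coordsD of_coordsZ scalerDr scalerA divff ?gt_eqF // scale1r.
  rewrite of_coordsD -scaleN1r of_coordsZ to_coordsK scalerDl scale1r scaleN1r.
  by rewrite [e + _]addrC -addrA; congr (_ + _); rewrite addrCA subrr addr0.
rewrite (peval_homog hyp) mulf_neq0 ?expf_neq0 ?(gt_eqF t1) //.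
apply: near0 => /=; rewrite opprD addNKr normrN normrZ distrC.
rewrite ger0_norm ?invr_ge0 ?(ltW t1) //; apply: le_lt_trans ur.
by rewrite ler_piMl // invf_le1 // lerDl.
Qed.

End Frames.

Theorem mainTheorem4 (R : realType) (V : vectType R) (n : nat)
  (p : polyOn V) (e : V) (hn : (2 <= n)%N)
  (hyp : hyperbolic_system n p e)
  (complete : complete_system n p e)
  (rog : ROG_cone n p e) :
  exists (k : nat) (c : 'I_k -> V), scaled_Jordan_frame n p e c.
Proof.
have n0 : (0 < n)%N by exact: ltnW.
have [w tr] := trace_linear hyp.
have clN : closure (rank_one_sums n p e) (to_coords e).
  apply: (@extreme_directions_dense _ _ (coords_cone n p e) _ w).
  - exact: closed_coords_cone.
  - by move=> u a a0; rewrite /coords_cone /= of_coordsZ; exact: cone_scale.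
  - move=> u Ku u0; rewrite -[u]of_coordsK -tr; apply: trace_gt0 => //.
    by apply: contraNneq u0 => h; rewrite -(of_coordsK u) h -of_coords0 of_coordsK.
  - exact: rank_one_sums0.
  - by move=> u a; exact: rank_one_sumsZ.
  - exact: rank_one_sumsD.
  - by move=> u; exact: extreme_rank_one.
  by have oe := nbhs_singleton (open_cone_nbhs hyp) => i; exact: ltW (oe i).
have [u [[k [c [Hc uE]]] /= open_u]] := clN _ (open_cone_nbhs hyp).
by exists k, c; split=> //; rewrite -uE.
Qed.
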